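(* Let $G$ be a locally compact Abelian group and let $\Omega_{+},\Omega_{-}\subset G$ be boundary-coherent symmetric subsets with $\Omega_{+}$ a neighbourhood of $0$. Then $$\mathcal{C}_{G}(\Omega_{+},\Omega_{-})=\mathcal{C}_{G}(\operatorname{int}\Omega_{+},\operatorname{int}\Omega_{-})=\mathcal{C}_{G}(\overline{\operatorname{int}\Omega_{+}},\overline{\operatorname{int}\Omega_{-}})=\mathcal{C}^{*}_{G}(\overline{\operatorname{int}\Omega_{+}},\overline{\operatorname{int}\Omega_{-}})=\mathcal{C}^{*}_{G}(\overline{\Omega_{+}},\overline{\Omega_{-}}).$$
   Context: All locally compact Abelian (LCA) groups are Hausdorff, written additively with identity $0$, and $\lambda_G$ denotes a fixed Haar measure on $G$. A set $\Omega\subset G$ is symmetric if $\Omega=-\Omega$. A neighbourhood of $0$ is a set containing an open set that contains $0$. $\operatorname{int}$ denotes interior. Here $A \subset B$ does not mean strict inclusion. A function $f:G\to\mathbb{R}$ is positive definite if $\sum_{i=1}^{n}\sum_{j=1}^{n}c_i\overline{c_j}f(g_i-g_j)\ge 0$ for all $n\in\mathbb{N}$, $c_i\in\mathbb{C}$, $g_i\in G$. $P_1(G)$ is the set of continuous positive definite functions $f:G\to\mathbb{R}$ with $f(0)=1$. Write $f_+:=\max\{f,0\}$, $f_-:=\max\{-f,0\}$, and $\operatorname{supp} f:=\overline{\{g\in G: f(g)\neq 0\}}$. For subsets $\Omega_+,\Omega_-\subset G$, $$\mathcal{F}_{G}(\Omega_{+},\Omega_{-}):=\{f\in P_1(G)\cap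 L^1(G): f^{-1}((0,\infty))\subset\Omega_{+},\ f^{-1}((-\infty,0))\subset\Omega_{-}\},$$ $$\mathcal{F}^{*}_{G}(\Omega_{+},\Omega_{-}):=\{f\in P_1(G)\cap L^1(G): \operatorname{supp} f_+\subset\Omega_{+},\ \operatorname{supp} f_-\subset\Omega_{-}\},$$ and $\mathcal{C}_{G}(\Omega_{+},\Omega_{-})$, respectively $\mathcal{C}^{*}_{G}(\Omega_{+},\Omega_{-})$, is the supremum (in $[0,\infty]$) of $\int_G f\,d\lambda_G$ over $f\in\mathcal{F}_{G}(\Omega_{+},\Omega_{-})$, respectively $f\in\mathcal{F}^{*}_{G}(\Omega_{+},\Omega_{-})$, with the convention that the value is $0$ if the class is empty. A subset $\Omega$ of a topological space $X$ is boundary-coherent if $\partial\Omega\subset\overline{\operatorname{ext}\Omega}$, where $\operatorname{ext}\Omega:=X\setminus\overline{\Omega}$. *)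

(* Defs.v *)
From HB Require Import structures.
From mathcomp Require Import all_boot all_order all_algebra.
From mathcomp Require Import complex.
From mathcomp Require Import all_classical all_reals all_analysis.

Set Implicit Arguments.
Unset Strict Implicit.
Unset Printing Implicit Defensive.

Import Order.TTheory GRing.Theory Num.Theory.
Import numFieldNormedType.Exports.

Local Open Scope classical_set_scope.
Local Open Scope ring_scope.

Definition boundary (T : topologicalType) (A : set T) : set T :=
  closure A `\` interior A.

Definition exterior (T : topologicalType) (A : set T) : set T :=
  ~` closure A.

Definition boundary_coherent (T : topologicalType) (A : set T) : Prop :=
  boundary A `<=` closure (exterior A).

Definition symmetric_set (G : zmodType) (A : set G) : Prop :=
  A = [set - x | x in A].

Definition supp (R : realType) (T : topologicalType) (f : T -> R) : set T :=
  closure [set x | f x != 0].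

Section LCA.
Variables (R : realType) (G : topologicalZmodType).

(* Measurable types must be pointed, which topological groups are not in the
   hierarchy: this copy of G is pointed at 0. *)
Definition pointed_group : Type := G.
HB.instance Definition _ := Choice.on pointed_group.
HB.instance Definition _ := isPointed.Build pointed_group (0 : G).

Definition borel : measurableType _ :=
  @g_sigma_algebraType pointed_group (@open G).

(* Nonzero translation-invariant Radon measure on the Borel sets: finite on
   compact sets, outer regular on Borel sets, inner regular on open sets. *)
Definition haar_measure (mu : {measure set borel -> \bar R}) : Prop :=
  [/\ mu [set: G] != 0%E,
      forall (x : G) (A : set G), measurable (A : set borel) ->
        mu [set x + y | y in A] = mu A,
      forall K : set G, compact K -> (mu K < +oo)%E,
      forall A : set G, measurable (A : set borel) ->
        mu A = ereal_inf [set mu U | U in [set U : set G | open U /\ A `<=` U]]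
    & forall U : set G, open U ->
        mu U = ereal_sup [set mu K | K in [set K : set G |
                                            compact K /\ K `<=` U]] ].

(* The order of R[i] is partial: 0 <= z means that z is real and
   nonnegative. *)
Definition positive_definite (f : G -> R) : Prop :=
  forall (n : nat) (c : 'I_n -> R[i]) (g : 'I_n -> G),
    0 <= \sum_(i < n) \sum_(j < n) c i * (c j)^* * (f (g i - g j))%:C%C.

Definition P1 : set (G -> R) :=
  [set f : G -> R | [/\ continuous f, positive_definite f & f 0 = 1]].

Variable mu : {measure set borel -> \bar R}.

Definition L1 : set (G -> R) :=
  [set f : G -> R | mu.-integrable [set: borel] (EFin \o f)].

Definition calF (Op Om : set G) : set (G -> R) :=
  [set f : G -> R | [/\ (P1 `&` L1) f, f @^-1` [set t | 0 < t] `<=` Op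
             & f @^-1` [set t | t < 0] `<=` Om]].

Definition calF_star (Op Om : set G) : set (G -> R) :=
  [set f : G -> R | [/\ (P1 `&` L1) f, supp f^\+ `<=` Op & supp f^\- `<=` Om]].

(* ereal_sup set0 is -oo, whence the case distinction. *)
Definition sup_integral (F : set (G -> R)) : \bar R :=
  if `[< F = set0 >] then 0%E
  else ereal_sup [set (\int[mu]_x (f x)%:E)%E | f in F].

Definition calC (Op Om : set G) : \bar R := sup_integral (calF Op Om).

Definition calC_star (Op Om : set G) : \bar R :=
  sup_integral (calF_star Op Om).

End LCA.

(* Main.v *)
Require Import Defs.
From HB Require Import structures.
From mathcomp Require Import all_boot all_order all_algebra.
From mathcomp Require Import complex.
From mathcomp Require Import all_classical all_reals all_analysis.

Import Order.TTheory GRing.Theory Num.Theory.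
Import numFieldNormedType.Exports.

Local Open Scope classical_set_scope.
Local Open Scope ring_scope.

(* Every continuous f has open sets {f > 0} and {f < 0}, and boundary coherence
   gives int (closure A) = int A. Hence {f > 0} lies in int A as soon as it lies
   in closure A, so the function classes being compared are all equal. *)

(** A point of [interior (closure A)] outside [interior A] would be a boundary point, hence adherent
    to [exterior A]; but [closure A] is a neighbourhood of it that misses [exterior A]. *)
Lemma interior_closure_coherent {T : topologicalType} {A : set T} :
  boundary_coherent A -> interior (closure A) = interior A.
Proof.
move=> cohA; apply/seteqP; split=> [x clAx|]; last first.
  exact/interiorS/subset_closure.
apply: contrapT => nAx.
have /cohA extAx : boundary A x by split=> //; exact: interior_subset clAx.
by have [y [nclAy /nclAy]] := extAx _ clAx.
Qed.

Lemma supp_funrpos (R : realType) (T : topologicalType) (f : T -> R) :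
  supp f^\+ = closure (f @^-1` [set t | 0 < t]).
Proof.
congr closure; apply/seteqP; split=> x; rewrite /= /funrpos maxEle.
  by case: ifP; rewrite ?eqxx // leNgt => /negbFE.
by move=> fx_gt0; rewrite leNgt fx_gt0 /= gt_eqF.
Qed.

Lemma supp_funrneg (R : realType) (T : topologicalType) (f : T -> R) :
  supp f^\- = closure (f @^-1` [set t | t < 0]).
Proof.
rewrite -funrposN supp_funrpos; congr closure.
by apply/seteqP; split=> x /=; rewrite oppr_gt0.
Qed.

Section coherent_subset.
Context {T : topologicalType} {A U : set T}.
Hypotheses (cohA : boundary_coherent A) (openU : open U).

Lemma open_sub_closure_coherent : (U `<=` closure A) = (U `<=` interior A).
Proof.
by rewrite (open_subsetE (closure A) openU) (interior_closure_coherent cohA).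
Qed.

(** [closure (interior A)] lies between [interior A] and [closure A], which have the same open
    subsets by coherence. *)
Lemma open_sub_closure_interior_coherent :
  (U `<=` closure (interior A)) = (U `<=` interior A).
Proof.
apply/propext; split=> UA; last exact: subset_trans UA (@subset_closure _ _).
rewrite -open_sub_closure_coherent; apply: subset_trans UA _.
exact: closureS (@interior_subset _ _).
Qed.

End coherent_subset.

Section function_classes.
Context {R : realType} {G : topologicalZmodType}.
Variable mu : {measure set (borel G) -> \bar R}.
Implicit Types Op Om : set G.

(** The sign sets of a continuous function are open, so [calF] depends on its two arguments only
    through their open subsets. *)
Lemma calF_eq Op Om Op' Om' :
    (forall U : set G, open U -> (U `<=` Op) = (U `<=` Op')) ->
    (forall U : set G, open U -> (U `<=` Om) = (U `<=` Om')) ->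
  calF mu Op Om = calF mu Op' Om'.
Proof.
move=> eqOp eqOm; apply/seteqP.
(* Stated as equalities of propositions, so that the same rewriting serves both inclusions. *)
suff eqF (f : G -> R) : continuous f -> (f @^-1` [set t | 0 < t] `<=` Op) =
      (f @^-1` [set t | 0 < t] `<=` Op') /\
    (f @^-1` [set t | t < 0] `<=` Om) = (f @^-1` [set t | t < 0] `<=` Om').
  by split=> f [PLf fp fm]; have [[/eqF[ep em] _ _] _] := PLf;
    (split=> //; [move: fp; rewrite ep | move: fm; rewrite em]).
move=> /continuousP cf; split; [apply: eqOp | apply: eqOm]; apply: cf.
  exact: open_gt.
exact: open_lt.
Qed.

(** The supports of [f^\+] and [f^\-] are the closures of the sign sets of [f], and a closed set
    contains a set as soon as it contains its closure's dense part, the set itself. *)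
Lemma calF_star_closure Op Om :
  calF_star mu (closure Op) (closure Om) = calF mu (closure Op) (closure Om).
Proof.
have closure_sub (A B : set G) : (closure A `<=` closure B) = (A `<=` closure B).
  apply/propext; split; first by apply: subset_trans; exact: subset_closure.
  by rewrite (closureE A); apply: smallest_sub; exact: closed_closure.
rewrite /calF_star /calF; apply/seteqP.
by split=> f /=; rewrite supp_funrpos supp_funrneg !closure_sub.
Qed.

End function_classes.

Theorem corollary27 (R : realType) (G : topologicalZmodType)
    (hausdorffG : hausdorff_space G)
    (locally_compactG : locally_compact [set: G])
    (lambda : {measure set (borel G) -> \bar R})
    (haar_lambda : haar_measure lambda)
    (Op Om : set G)
    (coherent_Op : boundary_coherent Op)
    (coherent_Om : boundary_coherent Om)
    (sym_Op : symmetric_set Op)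
    (sym_Om : symmetric_set Om)
    (nbhs_Op : nbhs (0 : G) Op) :
  [/\ calC lambda Op Om = calC lambda (interior Op) (interior Om),
      calC lambda (interior Op) (interior Om) =
        calC lambda (closure (interior Op)) (closure (interior Om)),
      calC lambda (closure (interior Op)) (closure (interior Om)) =
        calC_star lambda (closure (interior Op)) (closure (interior Om))
    & calC_star lambda (closure (interior Op)) (closure (interior Om)) =
        calC_star lambda (closure Op) (closure Om)].
Proof.
(* Once the starred classes are replaced by unstarred ones, the third equality is trivial; each of
   the other three leaves one goal on open subsets for each sign. *)
rewrite /calC_star !calF_star_closure /calC.
split=> //; congr sup_integral; apply: calF_eq => U oU.
- exact: open_subsetE.
- exact: open_subsetE.
- by rewrite open_sub_closure_interior_coherent.
- by rewrite open_sub_closure_interior_coherent.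
- by rewrite open_sub_closure_interior_coherent // open_sub_closure_coherent.
- by rewrite open_sub_closure_interior_coherent // open_sub_closure_coherent.
Qed.
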